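(* Let $M$ be an atom-free MVS and let $(X,\mathcal{T})$ be a metacompact locally $M$-metrizable topological space. Then $X$ is $M_{\infty}$-metrizable.
   Context: A metric value set (MVS) is a set $M$ with at least two elements and a binary operation $+$ such that: (M1) $+$ is associative; (M2) $+$ has a (two-sided) neutral element $e$, and we write $M^{*}=M\setminus\{e\}$; (M3) if $m_1+m_2=e$ then $m_1=m_2=e$; (M4) for all $m_1,m_2\in M^{*}$ there are $m_3\in M^{*}$ and $m_4,m_5\in M$ with $m_1=m_3+m_4$ and $m_2=m_3+m_5$. For $m_1,m_2\in M$ write $m_1\unlhd m_2$ if $m_1+m_3=m_2$ for some $m_3\in M$, and $m_1\lhd m_2$ if $m_1+m_3=m_2$ for some $m_3\in M^{*}$ (so $m\lhd m$ is possible). $M$ is atom-free if $+$ is commutative and for every $m\in M^{*}$ there is $n\in M^{*}$ with $n\lhd m$. For an MVS $M$, $M_\infty=M\cup\{\infty\}$, where $\infty\notin M$, is the MVS whose operation extends that of $M$ by $m+\infty=\infty+m=\infty$ for all $m\in M_\infty$. A quasimetric function is a map $f\colon X\times X\to M$ ($M$ an MVS) with $f(x,x)=e$ for all $x\in X$ and $f(x,z)\unlhd f(x,y)+f(y,z)$ for all $x,y,z\in X$ (no symmetry is required). It induces the topology $\mathcal{T}_f$ on $X$ in which, for every $x\in X$, the balls $B_f(x,m)=\{y\in X: f(x,y)\lhd m\}$, $m\in M^{*}$, form an open neighbourhood base at $x$. A topological space $(X,\mathcal{T})$ is $M$-metrizable if $\mathcal{T}=\mathcal{T}_f$ for some quasimetric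 function $f\colon X\times X\to M$. A topological space $X$ is locally $M$-metrizable if every $x\in X$ has an open neighbourhood $U$ whose relative topology is induced by a quasimetric function $f_U\colon U\times U\to M$. A topological space is metacompact if every open cover has an open refinement that is a point-finite cover (no separation axiom is assumed). *)

(* Defs.v *)
From HB Require Import structures.
From mathcomp Require Import all_boot.
From mathcomp Require Import all_classical.
From mathcomp Require Import topology.

Set Implicit Arguments.
Unset Strict Implicit.
Unset Printing Implicit Defensive.

Local Open Scope classical_set_scope.

Declare Scope mvs_scope.
Delimit Scope mvs_scope with M.

(** Metric value sets.  [M^*] is written as the side condition [m <> mvs_e]. *)
Record mvs := MVS {
  mvs_sort :> Type;
  mvs_add : mvs_sort -> mvs_sort -> mvs_sort;
  mvs_e : mvs_sort;
  mvs_two : exists a b : mvs_sort, a <> b;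
  mvs_addA : forall a b c, mvs_add a (mvs_add b c) = mvs_add (mvs_add a b) c;
  mvs_add0 : forall a, mvs_add mvs_e a = a;
  mvs_addr0 : forall a, mvs_add a mvs_e = a;
  mvs_add_eq0 : forall a b, mvs_add a b = mvs_e -> a = mvs_e /\ b = mvs_e;
  mvs_refine : forall m1 m2, m1 <> mvs_e -> m2 <> mvs_e ->
    exists m3 m4 m5,
      [/\ m3 <> mvs_e, m1 = mvs_add m3 m4 & m2 = mvs_add m3 m5] }.

Arguments mvs_e {m}.
Notation "a + b" := (mvs_add a b) : mvs_scope.
Local Open Scope mvs_scope.

Definition mvs_le (M : mvs) (m1 m2 : M) := exists m3 : M, m1 + m3 = m2.

(** Not the strict part of [mvs_le]: [mvs_lt m m] is possible. *)
Definition mvs_lt (M : mvs) (m1 m2 : M) :=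
  exists2 m3 : M, m3 <> mvs_e & m1 + m3 = m2.

Definition atom_free (M : mvs) :=
  (forall a b : M, a + b = b + a) /\
  (forall m : M, m <> mvs_e -> exists2 n : M, n <> mvs_e & mvs_lt n m).

(** [M_oo]: [None] plays the role of the added absorbing element. *)
Section Infinity.
Variable M : mvs.

Definition infty_add (a b : option M) : option M :=
  match a, b with
  | Some x, Some y => Some (x + y)
  | _, _ => None
  end.

Fact infty_two : exists a b : option M, a <> b.
Proof. by exists (Some mvs_e), None. Qed.

Fact infty_addA a b c :
  infty_add a (infty_add b c) = infty_add (infty_add a b) c.
Proof. by case: a b c => [a|] [b|] [c|] //=; rewrite mvs_addA. Qed.

Fact infty_add0 a : infty_add (Some mvs_e) a = a.
Proof. by case: a => [a|] //=; rewrite mvs_add0. Qed.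

Fact infty_addr0 a : infty_add a (Some mvs_e) = a.
Proof. by case: a => [a|] //=; rewrite mvs_addr0. Qed.

Fact infty_add_eq0 a b :
  infty_add a b = Some mvs_e -> a = Some mvs_e /\ b = Some mvs_e.
Proof. by case: a b => [a|] [b|] //= [] /mvs_add_eq0[-> ->]. Qed.

Fact infty_refine m1 m2 : m1 <> Some mvs_e -> m2 <> Some mvs_e ->
  exists m3 m4 m5,
    [/\ m3 <> Some mvs_e, m1 = infty_add m3 m4 & m2 = infty_add m3 m5].
Proof.
case: m1 m2 => [a|] [b|] ane bne.
- have ha : a <> mvs_e by move=> h; apply: ane; rewrite h.
  have hb : b <> mvs_e by move=> h; apply: bne; rewrite h.
  have [m3 [m4 [m5 [h3 -> ->]]]] := mvs_refine ha hb.
  by exists (Some m3), (Some m4), (Some m5); split=> // -[].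
- by exists (Some a), (Some mvs_e), None; rewrite infty_addr0.
- by exists (Some b), None, (Some mvs_e); rewrite infty_addr0.
- by exists None, None, None.
Qed.

Definition mvs_infty : mvs :=
  MVS infty_two infty_addA infty_add0 infty_addr0 infty_add_eq0 infty_refine.

End Infinity.

Definition quasimetric (M : mvs) (X : Type) (f : X -> X -> M) :=
  (forall x, f x x = mvs_e) /\
  (forall x y z, mvs_le (f x z) (f x y + f y z)).

Definition qball (M : mvs) (X : Type) (f : X -> X -> M) (x : X) (m : M) :
  set X := [set y | mvs_lt (f x y) m].

(** The topology of [X] is the one induced by [f]: at every point the balls of
    radius [m <> e] form an open neighbourhood base. *)
Definition induces (M : mvs) (X : topologicalType) (f : X -> X -> M) :=
  forall x : X,
    (forall m : M, m <> mvs_e -> open_nbhs x (qball f x m)) /\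
    (forall V : set X, nbhs x V ->
       exists2 m : M, m <> mvs_e & qball f x m `<=` V).

Definition metrizable (M : mvs) (X : topologicalType) :=
  exists2 f : X -> X -> M, quasimetric f & induces f.

(** [set_type U] carries the relative topology. *)
Definition locally_metrizable (M : mvs) (X : topologicalType) :=
  forall x : X, exists2 U : set X, open_nbhs x U & metrizable M (set_type U).

Definition open_cover (X : topologicalType) (C : set (set X)) :=
  C `<=` open /\ cover C id = setT.

Definition refines (X : Type) (D C : set (set X)) :=
  forall V, D V -> exists2 U, C U & V `<=` U.

Definition point_finite (X : Type) (D : set (set X)) :=
  forall x, finite_set [set V | D V /\ V x].

Definition metacompact (X : topologicalType) :=
  forall C : set (set X), open_cover C ->
    exists D : set (set X), [/\ open_cover D, refines D C & point_finite D].

(* Main.v *)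
Require Import Defs.
From mathcomp Require Import topology.
From HB Require Import structures.
From mathcomp Require Import all_boot all_classical.

                                                                             
                                                                            
                                                                              
                             
                                          
                                                     
                                           
                                                                                
                                                                             
                                                                                
                                                                           

                                                                         
                                                                        
                                                                  
                                                                               
                                                                             
                                                                               
                                                                          
                                              

Set Implicit Arguments.
Unset Strict Implicit.
Unset Printing Implicit Defensive.

Local Open Scope classical_set_scope.
Local Open Scope mvs_scope.

                                                

Section Order.
Context {M : mvs}.
Implicit Types a b c d : M.

Lemma mvs_le_refl a : mvs_le a a.
Proof. by exists mvs_e; rewrite mvs_addr0. Qed.

Lemma mvs_le_trans a b c : mvs_le a b -> mvs_le b c -> mvs_le a c.
Proof. by move=> [k <-] [l <-]; exists (k + l); rewrite mvs_addA. Qed.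

Lemma mvs_le_lt_trans a b c : mvs_le a b -> mvs_lt b c -> mvs_lt a c.
Proof.
move=> [k <-] [l ne <-]; exists (k + l); last by rewrite mvs_addA.
by move=> /mvs_add_eq0[].
Qed.

Lemma mvs_lt_le_trans a b c : mvs_lt a b -> mvs_le b c -> mvs_lt a c.
Proof.
move=> [k ne <-] [l <-]; exists (k + l); last by rewrite mvs_addA.
by move=> /mvs_add_eq0[].
Qed.

Lemma mvs_lt_e a : a <> mvs_e -> mvs_lt mvs_e a.
Proof. by move=> ne; exists a => //; rewrite mvs_add0. Qed.

Hypothesis addC : forall a b, a + b = b + a.

Lemma mvs_addACA a b c d : (a + b) + (c + d) = (a + c) + (b + d).
Proof. by rewrite -!mvs_addA (mvs_addA b) (addC b c) -(mvs_addA c). Qed.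

Lemma mvs_le_add a b c d : mvs_le a b -> mvs_le c d -> mvs_le (a + c) (b + d).
Proof. by move=> [k <-] [l <-]; exists (k + l); rewrite mvs_addACA. Qed.

Lemma mvs_lt_add a b c d : mvs_lt a b -> mvs_lt c d -> mvs_lt (a + c) (b + d).
Proof.
move=> [k ne <-] [l _ <-]; exists (k + l); last by rewrite mvs_addACA.
by move=> /mvs_add_eq0[].
Qed.

End Order.

                                                                                
                                   
Lemma mvs_half (M : mvs) (m : M) : atom_free M -> m <> mvs_e ->
  exists2 r : M, r <> mvs_e & mvs_le (r + r) m.
Proof.
move=> [addC below] /below[n n0 [p p0 <-]].
have [r [a [b [r0 -> ->]]]] := mvs_refine n0 p0.
by exists r => //; exists (a + b); rewrite mvs_addACA.
Qed.

Lemma infty_atom_free (M : mvs) : atom_free M -> atom_free (mvs_infty M).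
Proof.
move=> [addC below]; split=> [[a|] [b|] //=|]; first by rewrite addC.
case=> [m|] m0; last by exists None => //; exists None.
have /below[n n0 [p p0 npm]] : m <> mvs_e by move=> h; apply: m0; rewrite h.
exists (Some n); first by case.
by exists (Some p) => /=; [case|rewrite npm].
Qed.

                             

(** Openness of the balls comes for free: if [f x y + n = m] with [n <> e], the
    triangle inequality puts the ball of radius [n] at [y] inside the ball of
    radius [m] at [x]. *)
Lemma nbhs_qball_open (M : mvs) (X : topologicalType) (f : X -> X -> M) :
  quasimetric f ->
  (forall x m, m <> mvs_e -> nbhs x (qball f x m)) ->
  forall x m, m <> mvs_e -> open_nbhs x (qball f x m).
Proof.
move=> [f0 ftri] fnbhs x m m0; split; last first.
  by rewrite /qball /= f0; apply: mvs_lt_e.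
rewrite openE => y [n n0 fn] /=.
apply: filterS (fnbhs y n n0) => z fyz; apply: mvs_le_lt_trans (ftri x y z) _.
by case: fyz => k k0 kn; exists k => //; rewrite -mvs_addA kn.
Qed.

                                                                               
                                                    
Definition mvs_com_law (M : mvs) (addC : commutative (@mvs_add M)) :
    Monoid.com_law (@mvs_e M) :=
  HB.pack (@mvs_add M)
    (Monoid.isComLaw.Build M mvs_e (@mvs_add M)
       (@mvs_addA M) addC (@mvs_add0 M)).

Section Sum.
Context {M : mvs} (addC : commutative (@mvs_add M)).
Context {I : choiceType} {X : Type} (d : I -> X -> X -> M).
Hypothesis d_quasimetric : forall i, quasimetric (d i).
Hypothesis d_support : forall x,
  exists2 A : set I, finite_set A & forall i y, d i x y <> mvs_e -> A i.

Local Notation add := (mvs_com_law addC).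

Definition qsum (x y : X) : M := \big[add/mvs_e]_(i \in setT) d i x y.

Lemma qsumE (A : set I) x y : finite_set A ->
    (forall i, d i x y <> mvs_e -> A i) ->
  qsum x y = \big[add/mvs_e]_(i <- finmap.enum_fset (fset_set A)) d i x y.
Proof.
move=> finA supp; rewrite -(fsbig_finite add) // /qsum.
apply/esym; apply: (fsbig_widen (op := add)) => // i [_ nA] /=.
by apply: contrapT => /supp.
Qed.

Lemma le_qsum i x y : mvs_le (d i x y) (qsum x y).
Proof.
have [A finA supp] := d_support x.
have finAi : finite_set (A `|` [set i]) by rewrite finite_setU.
rewrite (qsumE finAi); last by move=> j /supp; left.
rewrite -(fsbig_finite add) // (fsbigD1 (op := add) i) //=; last by right.
by eexists; reflexivity.
Qed.

Lemma sum_quasimetric : quasimetric qsum.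
Proof.
split=> [x|x y z].
  rewrite /qsum; apply: (fsbig1 add) => i _.
  by have [-> //] := d_quasimetric i.
have [A finA suppA] := d_support x; have [B finB suppB] := d_support y.
have finAB : finite_set (A `|` B) by rewrite finite_setU.
rewrite !(qsumE finAB) => [||i /suppA|i /suppA];
  [|by move=> i /suppB; right|by left..].
set s := finmap.enum_fset _.
have /= <- := big_split add s xpredT (fun i => d i x y) (fun i => d i y z).
apply: (big_ind2 (fun a b : M => mvs_le a b)) => [||i _].
- exact: mvs_le_refl.
- by move=> a b c e; apply: mvs_le_add.
- by have [_] := d_quasimetric i.
Qed.

End Sum.

                                                                            
Lemma nbhs_sum_ball (M : mvs) (M_atom_free : atom_free M) (I : choiceType)
    (X : topologicalType) (d : I -> X -> X -> M) :
    (forall x, exists2 A : set I, finite_set A &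
      forall i y, d i x y <> mvs_e -> A i) ->
    (forall i x m, m <> mvs_e -> nbhs x (qball (d i) x m)) ->
  forall x m, m <> mvs_e -> nbhs x (qball (qsum (proj1 M_atom_free) d) x m).
Proof.
move=> supp dnbhs x m m0; have [A finA suppA] := supp x.
set s := finmap.enum_fset (fset_set A).
suff : nbhs x [set y |
    mvs_lt (\big[mvs_com_law (proj1 M_atom_free)/mvs_e]_(i <- s) d i x y) m].
  apply: filterS => y /=; rewrite /qball /= (qsumE _ finA) // => i.
  exact: suppA.
elim: s m m0 => [|i s IHs] m m0.
  by apply: filterE => y /=; rewrite big_nil; apply: mvs_lt_e.
have [r r0 rm] := mvs_half M_atom_free m0.
apply: filterS2 (dnbhs i x r r0) (IHs r r0) => y dir sr /=.
rewrite big_cons; apply: mvs_lt_le_trans rm.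
by apply: mvs_lt_add => //; apply: (proj1 M_atom_free).
Qed.

                                                 

Section Extension.
Context {M : mvs} {X : topologicalType} {U V : set X}.
Context (f : set_type U -> set_type U -> M).
Hypothesis f_quasimetric : quasimetric f.
Hypothesis f_induces : induces f.
Hypothesis VU : V `<=` U.

Definition extension (x y : X) : mvs_infty M :=
  match pselect (V x), pselect (V y) with
  | right _, _ => Some mvs_e
  | left _, right _ => None
  | left Vx, left Vy =>
      Some (f (SigSub (mem_set (VU Vx))) (SigSub (mem_set (VU Vy))))
  end.

Lemma extension_out x y : ~ V x -> extension x y = Some mvs_e.
Proof. by rewrite /extension; case: pselect. Qed.

Lemma extension_exit x y : V x -> ~ V y -> extension x y = None.
Proof. by rewrite /extension; case: pselect => // ?; case: pselect. Qed.

Lemma extension_in (a b : set_type U) : V (val a) -> V (val b) ->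
  extension (val a) (val b) = Some (f a b).
Proof.
rewrite /extension; case: pselect => // Va _; case: pselect => // Vb _.
by congr (Some (f _ _)); apply: val_inj.
Qed.

Lemma extension_quasimetric : quasimetric extension.
Proof.
have [f0 ftri] := f_quasimetric.
have lift x : V x -> exists a : set_type U, val a = x.
  by move=> Vx; exists (SigSub (mem_set (VU Vx))).
split=> [x|x y z].
  case: (pselect (V x)) => [Vx|nVx]; last exact: extension_out.
  by have [a ax] := lift x Vx; subst x; rewrite extension_in // f0.
case: (pselect (V x)) => [Vx|nVx]; last first.
  by rewrite (extension_out z nVx); eexists; apply: (@mvs_add0 (mvs_infty M)).
case: (pselect (V y)) => [Vy|nVy]; last first.
  by rewrite (extension_exit Vx nVy); exists None; case: extension.
case: (pselect (V z)) => [Vz|nVz]; last first.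
  by rewrite (extension_exit Vx nVz) (extension_exit Vy nVz);
    exists None; case: extension.
have [a ax] := lift x Vx; have [b bx] := lift y Vy; have [c cx] := lift z Vz.
subst x y z; rewrite !extension_in //.
by have [k kE] := ftri a b c; exists (Some k) => /=; rewrite kE.
Qed.

Lemma nbhs_extension_ball (openV : open V) x m : m <> mvs_e ->
  nbhs x (qball extension x m).
Proof.
move=> m0; case: (pselect (V x)) => [Vx|nVx]; last first.
  by apply: filterE => y; rewrite /qball /= extension_out //; apply: mvs_lt_e.
case: m m0 => [m|] m0; last first.
  by apply: filterE => y; exists None => //; case: extension.
have {}m0 : m <> mvs_e by move=> h; apply: m0; rewrite h.
pose a : set_type U := SigSub (mem_set (VU Vx)).
have [[W openW WE] aW] := (f_induces a).1 m m0.
have Wx : W x by move: aW; rewrite -WE.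
apply: filterS2 (open_nbhs_nbhs (conj openW Wx))
  (open_nbhs_nbhs (conj openV Vx)).
move=> y Wy Vy; pose b : set_type U := SigSub (mem_set (VU Vy)).
rewrite /qball /= -[x]/(val a) -[y]/(val b) extension_in //.
have [k k0 kE] : qball f a m b by rewrite -WE.
by exists (Some k); [case|rewrite /= kE].
Qed.

Lemma extension_ball_sub x N : V x -> nbhs x N ->
  exists2 m : mvs_infty M, m <> mvs_e & qball extension x m `<=` N.
Proof.
move=> Vx Nx; pose a : set_type U := SigSub (mem_set (VU Vx)).
have Na : nbhs a (val @^-1` N).
  by apply: (@initial_continuous _ _ (val : set_type U -> X) a).
have [m m0 mN] := (f_induces a).2 _ Na.
exists (Some m); first by case.
move=> y; rewrite /qball /=; case: (pselect (V y)) => [Vy|nVy]; last first.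
  by rewrite extension_exit // => -[k _]; case: k.
pose b : set_type U := SigSub (mem_set (VU Vy)).
rewrite -[x]/(val a) -[y]/(val b) extension_in // => -[[k|//] k0 [kE]].
by apply: (mN b); exists k => // h; apply: k0; rewrite h.
Qed.

End Extension.

                      

                                                                               
                                                                           
                                           
Lemma metrizable_of_family (M : mvs) (X : topologicalType) (I : choiceType)
    (d : I -> X -> X -> M) :
    atom_free M ->
    (forall i, quasimetric (d i)) ->
    (forall x, exists2 A : set I, finite_set A &
      forall i y, d i x y <> mvs_e -> A i) ->
    (forall i x m, m <> mvs_e -> nbhs x (qball (d i) x m)) ->
    (forall x N, nbhs x N -> exists i,
      exists2 m, m <> mvs_e & qball (d i) x m `<=` N) ->
  metrizable M X.
Proof.
move=> Maf dq supp dnbhs dsub; exists (qsum (proj1 Maf) d).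
  exact: sum_quasimetric.
move=> x; split=> [m m0|N /dsub[i [m m0 mN]]].
  apply: nbhs_qball_open => //; first exact: sum_quasimetric.
  exact: nbhs_sum_ball.
exists m => // y; rewrite /qball /= => ltm; apply: mN.
by apply: mvs_le_lt_trans ltm; apply: le_qsum.
Qed.

Theorem theorem1p10 (M : mvs) (X : topologicalType)
    (M_atom_free : atom_free M)
    (X_metacompact : metacompact X)
    (X_locally_metrizable : locally_metrizable M X) :
  metrizable (mvs_infty M) X.
Proof.
have [|D [[openD coverD] refD finD]] :=
    X_metacompact [set U | open U /\ metrizable M (set_type U)].
  split=> [U []//|]; rewrite -subTset => x _.
  have [U [openU Ux] metU] := X_locally_metrizable x.
  by exists U.
have /choice[d dP] : forall V : set X, exists g : X -> X -> mvs_infty M,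
    [/\ quasimetric g,
        forall x y, g x y <> mvs_e -> D V /\ V x,
        forall x m, m <> mvs_e -> nbhs x (qball g x m) &
        forall x N, D V -> V x -> nbhs x N ->
          exists2 m, m <> mvs_e & qball g x m `<=` N].
  move=> V; case: (pselect (D V)) => [DV|nDV]; last first.
                                                             
    exists (fun _ _ => mvs_e); split=> //.
      by split=> // *; eexists; apply: mvs_add0.
    by move=> x m m0; apply: filterE => y; apply: mvs_lt_e.
  have [U [_ [f fq fi]] VU] := refD V DV.
  exists (extension f VU); split.
  - exact: extension_quasimetric.
  - by move=> x y ne; split=> //; apply: contrapT => /extension_out/ne.
  - by move=> x m; apply: nbhs_extension_ball => //; apply: openD.
  - by move=> x N _; apply: extension_ball_sub.
apply: (metrizable_of_family (d := d)).
- exact: infty_atom_free.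
- by move=> V; have [] := dP V.
- move=> x; exists [set V | D V /\ V x]; first exact: finD.
  by move=> V y; have [_ + _ _] := dP V; apply.
- by move=> V; have [] := dP V.
- move=> x N Nx; have : cover D id x by rewrite coverD.
  by move=> [V DV Vx]; exists V; have [_ _ _] := dP V; apply.
Qed.
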